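(* Let $\mathcal{X}$ be a nonempty compact subset of $\mathbb{R}$. If the functions $x\mapsto f(x,\zeta_i)$, $i=1,2,\ldots,p$, are all increasing on $\mathcal{X}$, then the GOWA robust objective function $$\phi(x)=\left(\sum_{i=1}^{p}w_i\,(s_i(x))^{\lambda}\right)^{1/\lambda},\qquad x\in\mathcal{X},$$ is increasing on $\mathcal{X}$.
   Context: Setting: $\Omega=\{\zeta_1,\ldots,\zeta_p\}\subseteq\mathbb{R}^m$ is a finite (ordered) uncertainty set, and $f:\mathcal{X}\times\Omega\to\mathbb{R}$ satisfies $f(x,\zeta)\ge 0$ for all $x\in\mathcal{X}$, $\zeta\in\Omega$. The uncertain single objective optimization problem $\mathcal{P}(\Omega)$ is the family of problems $\min_{x\in\mathcal{X}} f(x,\zeta)$, $\zeta\in\Omega$. Auxiliary functions $s_1,\ldots,s_p:\mathcal{X}\to\mathbb{R}$: for each $x$, recursively for $i=1,\ldots,p$, let $j_i(x)$ be the smallest index among those $j\in\{1,\ldots,p\}\setminus\{j_1(x),\ldots,j_{i-1}(x)\}$ at which $f(x,\zeta_j)$ is maximal over that remaining index set, and put $s_i(x)=f(x,\zeta_{j_i(x)})$. Thus exactly one index is removed at each step, so $s_i(x)$ is the $i$-th largest of the values $f(x,\zeta_1),\ldots,f(x,\zeta_p)$ counted with multiplicity. Parameters: a real $\lambda>0$ and weights $w_i\ge 0$, $i=1,\ldots,p$, with $\sum_{i=1}^p w_i=1$, all given. A function $g:\mathcal{X}\to\mathbb{R}$ is increasing if $x_1\ge x_2$ implies $g(x_1)\ge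 g(x_2)$ for $x_1,x_2\in\mathcal{X}$. *)

(* Defs.v *)
From HB Require Import structures.
From mathcomp Require Import all_boot all_order all_algebra.
From mathcomp Require Import all_classical all_reals all_analysis.
Set Implicit Arguments.
Unset Strict Implicit.
Unset Printing Implicit Defensive.
Import Order.TTheory GRing.Theory Num.Theory.
Import numFieldNormedType.Exports.
Local Open Scope classical_set_scope.
Local Open Scope ring_scope.

(* The indices outside the set D of removed ones at which a is maximal over
   the complement of D. *)
Definition argmaxs (R : realType) (p : nat) (a : 'I_p -> R) (D : {set 'I_p}) :
    {set 'I_p} :=
  [set j | (j \notin D) && [forall (k | k \notin D), a k <= a j]]%SET.

(* None only when every index has been removed. *)
Definition next_index (R : realType) (p : nat) (a : 'I_p -> R)
    (D : {set 'I_p}) : option 'I_p :=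
  [pick j in argmaxs a D | [forall k in argmaxs a D, (j <= k)%N]].

(* removed a i = {j_1, ..., j_i}. *)
Fixpoint removed (R : realType) (p : nat) (a : 'I_p -> R) (i : nat) :
    {set 'I_p} :=
  if i is i'.+1 then
    let D := removed a i' in
    if next_index a D is Some j then (j |: D)%SET else D
  else finset.set0.

(* Indices start at 0: for i : 'I_p, this is s_{i+1}(x), with f, zeta and x as
   below.  The default value 0 is never reached, because fewer than p indices
   have been removed at step i. *)
Definition s_fun (R : realType) (m p : nat) (zeta : 'I_p -> 'rV[R]_m)
    (f : R -> 'rV[R]_m -> R) (i : 'I_p) (x : R) : R :=
  let a := fun j : 'I_p => f x (zeta j) in
  if next_index a (removed a i) is Some j then a j else 0.

Definition gowa (R : realType) (m p : nat) (zeta : 'I_p -> 'rV[R]_m)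
    (f : R -> 'rV[R]_m -> R) (w : 'I_p -> R) (lambda : R) (x : R) : R :=
  (\sum_(i < p) w i * s_fun zeta f i x `^ lambda) `^ (lambda^-1).

(* Increasing in the weak sense. *)
Definition increasing_on (R : realType) (X : set R) (g : R -> R) : Prop :=
  forall x1 x2, X x1 -> X x2 -> x1 >= x2 -> g x1 >= g x2.

(* Main.v *)
Require Import Defs.
From HB Require Import structures.
From mathcomp Require Import all_boot all_order all_algebra.
From mathcomp Require Import all_classical all_reals all_analysis.
Import Order.TTheory GRing.Theory Num.Theory.
Import numFieldNormedType.Exports.
Local Open Scope classical_set_scope.
Local Open Scope ring_scope.

(** Sorting preserves the pointwise order: if b <= a entrywise, then the
    (i+1)-st largest entry of b is at most the (i+1)-st largest entry of a.
    To see this, let D be the set of i indices that the selection for a has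
    already removed, and let j be the index selected next for b.  The index j
    together with the indices removed before it for b makes i+1 indices, at all
    of which b is at least b j ([removed_ge]).  By cardinality ([card_removed])
    one of them, say k, lies outside D, so the entry selected next for a is at
    least a k >= b k >= b j ([selected_entry_le]).

    Applied to the values of f at two points of X, this makes every s_i
    increasing.  As the s_i and the weights are nonnegative and both lambda and
    its inverse are nonnegative exponents, the weighted power mean is increasing
    as well. *)

Section Selection.
Set Implicit Arguments.
Unset Strict Implicit.
Variables (R : realType) (p : nat).
Implicit Types (a b : 'I_p -> R) (D : {set 'I_p}) (i : nat) (j k : 'I_p).

Lemma next_index_max a D j : next_index a D = Some j ->
  j \notin D /\ forall k, k \notin D -> a k <= a j.
Proof.
rewrite /next_index; case: pickP => // l /andP[lA _] [<-]; move: lA.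
by rewrite inE => /andP[jD /forall_inP aj].
Qed.

(** Ties are broken by taking the least index among the maximizers of a off D,
    so two successive extremal choices are needed: a maximizer, and then a
    least one. *)
Lemma next_index_exists a D : (#|D| < p)%N -> exists j, next_index a D = Some j.
Proof.
move=> Dp; have [k0 k0D] : exists k, k \notin D.
  apply/existsP; rewrite -negb_forall; apply: contraL Dp => /forallP allD.
  by rewrite -leqNgt -[leqLHS]card_ord subset_leq_card //; apply/fintype.subsetP.
have [k1 k1D k1max] := @Order.TotalTheory.arg_maxP _ _ _ k0 (fun k => k \notin D) a k0D.
have k1A : k1 \in argmaxs a D by rewrite inE k1D; apply/forall_inP.
have [j jA jmin] := @arg_minnP _ k1 (fun k => k \in argmaxs a D) (@nat_of_ord p) k1A.
rewrite /next_index; case: pickP => [l _|/(_ j)]; first by exists l.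
by rewrite jA => /negP[]; apply/forall_inP.
Qed.

Lemma card_removed a i : (i <= p)%N -> #|removed a i| = i.
Proof.
elim: i => [|i IHi] ip /=; first by rewrite cards0.
have Di := IHi (ltnW ip).
have [|j nj] := @next_index_exists a (removed a i); first by rewrite Di.
by rewrite nj cardsU1 (next_index_max nj).1 Di.
Qed.

(** An index removed at some step was a maximizer among all indices remaining at
    that step, which include those that remain later. *)
Lemma removed_ge a i k l :
  k \in removed a i -> l \notin removed a i -> a l <= a k.
Proof.
elim: i => [|i IHi] /=; first by rewrite inE.
case nj : (next_index a _) => [j|//]; rewrite !inE negb_or => + /andP[_ lD].
by case/orP => [/eqP ->|kD]; [exact: (next_index_max nj).2 | exact: IHi].
Qed.

(** The counting argument: the i indices removed for a cannot cover the i+1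
    indices consisting of j' and those removed for b. *)
Lemma selected_entry_le a b i j j' : (i < p)%N -> (forall k, b k <= a k) ->
  next_index a (removed a i) = Some j -> next_index b (removed b i) = Some j' ->
  b j' <= a j.
Proof.
move=> ip ba /next_index_max[_ jmax] /next_index_max[j'D _].
have /fintype.subsetPn[k kB kD] : ~~ ((j' |: removed b i)%SET \subset removed a i).
  apply/negP => /subset_leq_card.
  by rewrite cardsU1 j'D !card_removed ?ltnn // ltnW.
apply: le_trans (jmax _ kD); apply: le_trans (ba k).
by move: kB; rewrite !inE => /orP[/eqP ->|kB] //; apply: removed_ge kB j'D.
Qed.

End Selection.

Lemma s_fun_ge0 (R : realType) (m p : nat) (zeta : 'I_p -> 'rV[R]_m)
    (f : R -> 'rV[R]_m -> R) (i : 'I_p) (x : R) :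
  (forall j, 0 <= f x (zeta j)) -> 0 <= s_fun zeta f i x.
Proof. by move=> f0; rewrite /s_fun; case: next_index. Qed.

Lemma s_fun_le (R : realType) (m p : nat) (zeta : 'I_p -> 'rV[R]_m)
    (f : R -> 'rV[R]_m -> R) (i : 'I_p) (x y : R) :
  (forall j, f x (zeta j) <= f y (zeta j)) ->
  s_fun zeta f i x <= s_fun zeta f i y.
Proof.
move=> fxy; rewrite /s_fun.
set b := fun j => f x (zeta j); set a := fun j => f y (zeta j).
have sel (c : 'I_p -> R) : exists j, next_index c (removed c i) = Some j.
  by apply: next_index_exists; rewrite card_removed // ltnW.
have [[j aj] [j' bj']] := (sel a, sel b).
by rewrite aj bj'; apply: selected_entry_le aj bj'.
Qed.

Theorem theorem3p10 (R : realType) (m p : nat) (X : set R)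
    (zeta : 'I_p -> 'rV[R]_m) (f : R -> 'rV[R]_m -> R)
    (w : 'I_p -> R) (lambda : R)
    (X_nonempty : X !=set0) (X_compact : compact X)
    (f_ge0 : forall x i, X x -> 0 <= f x (zeta i))
    (lambda_gt0 : 0 < lambda)
    (w_ge0 : forall i, 0 <= w i) (w_sum1 : \sum_(i < p) w i = 1)
    (f_incr : forall i, increasing_on X (fun x => f x (zeta i))) :
  increasing_on X (gowa zeta f w lambda).
Proof.
move=> x1 x2 Xx1 Xx2 x21.
have s0 i x : X x -> 0 <= s_fun zeta f i x.
  by move=> Xx; apply: s_fun_ge0 => j; apply: f_ge0.
have sum_ge0 x : 0 <= \sum_(i < p) w i * s_fun zeta f i x `^ lambda.
  by apply: sumr_ge0 => i _; rewrite mulr_ge0 ?powR_ge0.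
apply: ge0_ler_powR; rewrite ?nnegrE ?invr_ge0 ?(ltW lambda_gt0) //.
apply: ler_sum => i _; apply: ler_wpM2l => //.
apply: ge0_ler_powR; rewrite ?nnegrE ?s0 ?(ltW lambda_gt0) //.
by apply: s_fun_le => j; apply: f_incr.
Qed.
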